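(* Let $(A,\circ)$ be a finite-dimensional commutative associative algebra and $(V,\rho_\circ)$ a finite-dimensional $(A,\circ)$-module. Let $(A_h,\circ_h)$ be an associative deformation of $(A,\circ)$ with quasiclassical limit $(A,\{,\},\circ)$, and let $(V_h,l_{\circ_h},r_{\circ_h})$ be an $A_h$-bimodule deformation of $(V,\rho_\circ)$ with quasiclassical limit the $(A,\{,\},\circ)$-module $(V,\rho_{\{,\}},\rho_\circ)$. Let $T\in\mathrm{Hom}_{\mathbf k}(V,A)$ with scalar deformation $T_{\mathbf K}:V_h\to A_h$. Put $r:=\eta(\tilde T)-\sigma(\eta(\tilde T))\in(A\oplus V^* )^{\otimes2}$ and $r_h:=\eta_h(\widetilde{T_{\mathbf K}})-\sigma_{\mathbf K}(\eta_h(\widetilde{T_{\mathbf K}}))\in(A\oplus V^* )_h\hat\otimes(A\oplus V^* )_h$. Then: (1) The topologically free associative algebra $A_h\ltimes_{-r^\star_{\circ_h},-l^\star_{\circ_h}}V_h^\star$ is an associative deformation of the commutative associative algebra $A\ltimes_{-\rho_\circ^*}V^*$, and its quasiclassical limit is exactly the Poisson algebra $A\ltimes_{\rho^*_{\{,\}},-\rho^*_\circ}V^*$. (2) Assume that $T$ is an $\mathcal O$-operator on $(A,\circ)$ associated to $(V,\rho_\circ)$ and $T_{\mathbf K}$ is an $\mathcal O$-operator on $(A_h,\circ_h)$ associated to $(V_h,l_{\circ_h},r_{\circ_h})$. Then the skew-symmetric solution $r_h$ of the AYBE in $A_h\ltimes_{-r^\star_{\circ_h},-l^\star_{\circ_h}}V_h^\star$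 induced by $T_{\mathbf K}$ coincides with the scalar deformation $\hat r$ of the skew-symmetric solution $r$ of the AYBE in $A\ltimes_{-\rho_\circ^*}V^*$ induced by $T$. Moreover, the skew-symmetric solution of the PYBE in $A\ltimes_{\rho^*_{\{,\}},-\rho^*_\circ}V^*$ induced by $T$, regarded as an $\mathcal O$-operator on $(A,\{,\},\circ)$ associated to $(V,\rho_{\{,\}},\rho_\circ)$ (the quasiclassical limit of the $\mathcal O$-operator $T_{\mathbf K}$), is $r$ and coincides with the solution of the PYBE obtained from the solution $r_h=\hat r$ of the AYBE in $A_h\ltimes_{-r^\star_{\circ_h},-l^\star_{\circ_h}}V_h^\star$ by passing to the quasiclassical limit.
   Context: Throughout, $\mathbf{k}$ is a field of characteristic $0$, $\mathbf{K}=\mathbf{k}[[h]]$, $V_h=V[[h]]$; $\hat\otimes$ is the $h$-adically completed tensor product over $\mathbf K$, $V_h\hat\otimes W_h\cong(V\otimes W)[[h]]$. An associative deformation of $(A,\circ)$ is a $\mathbf K$-bilinear associative product $\circ_h$ on $A_h$ with $x\circ_hy\equiv x\circ y\pmod h$ for $x,y\in A$; for $(A,\circ)$ commutative its quasiclassical limit (QCL) is the Poisson algebra $(A,\{,\},\circ)$, $\{x,y\}\equiv\frac{x\circ_hy-y\circ_hx}{h}\pmod h$. An $A$-bimodule is $(V,l,r)$ with $A\oplus V$ associative under $(x,u)\odot(y,v)=(x\circ y,l(x)v+r(y)u)$, written $A\ltimes_{l,r}V$; for commutative $A$, an $A$-module $(V,\rho_\circ)$ is the case $l=r=\rho_\circ$,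 written $A\ltimes_{\rho_\circ}V$. A module $(V,\rho_{\{,\}},\rho_\circ)$ over a Poisson algebra $(A,\{,\},\circ)$ is such that $A\oplus V$ with bracket $(\{x,y\},\rho_{\{,\}}(x)v-\rho_{\{,\}}(y)u)$ and product $(x\circ y,\rho_\circ(x)v+\rho_\circ(y)u)$ is a Poisson algebra, written $A\ltimes_{\rho_{\{,\}},\rho_\circ}V$. A topologically free $A_h$-bimodule $(V_h,l_{\circ_h},r_{\circ_h})$ is the analogous notion over $\mathbf K$; it is an $A_h$-bimodule deformation of $(V,l,r)$ if $A_h\ltimes V_h$ is an associative deformation of $A\ltimes_{l,r}V$; the QCL of a deformation of $(V,\rho_\circ)$ is $(V,\rho_{\{,\}},\rho_\circ)$ with $\rho_{\{,\}}(x)u\equiv\frac{l_{\circ_h}(x)u-r_{\circ_h}(x)u}{h}\pmod h$. Duals: for $\varrho:A\to\mathrm{End}(V)$, $\langle\varrho^*(x)u^*,v\rangle=-\langle u^*,\varrho(x)v\rangle$ defines $\varrho^*:A\to\mathrm{End}(V^* )$. $V_h^\star:=(V^* )_h\cong\mathrm{Hom}_{\mathbf K}(V_h,\mathbf K)$ with $\mathbf K$-bilinear pairing $\langle,\rangle_{\mathbf K}$, and $\varrho_h^\star$ is defined by $\langle\varrho_h^\star(x)u^\star,v\rangle_{\mathbf K}=-\langle u^\star,\varrho_h(x)v\rangle_{\mathbf K}$. The dual bimodules of $(V,\rho_\circ)$, $(V_h,l_{\circ_h},r_{\circ_h})$, $(V,\rho_{\{,\}},\rho_\circ)$ are $(V^*,-\rho_\circ^*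 )$, $(V_h^\star,-r^\star_{\circ_h},-l^\star_{\circ_h})$, $(V^*,\rho^*_{\{,\}},-\rho^*_\circ)$. $\mathcal O$-operators (on bimodules, so weight is irrelevant): $T(u)\circ T(v)=T(l(T(u))v)+T(r(T(v))u)$; in the Poisson case $T(u)\circ T(v)=T(\rho_\circ(T(u))v)+T(\rho_\circ(T(v))u)$ and $\{T(u),T(v)\}=T(\rho_{\{,\}}(T(u))v)-T(\rho_{\{,\}}(T(v))u)$. Scalar deformations: $T_{\mathbf K}(\sum v_ih^i)=\sum T(v_i)h^i$; for a tensor $r\in B\otimes B$, $\hat r$ is its image in $B_h\hat\otimes B_h\cong(B\otimes B)[[h]]$. $\tilde T\in A\otimes V^*$ is the tensor of $T:V\to A$ (i.e. $\tilde T=\sum_iT(e_i)\otimes e_i^*$ for a basis $(e_i)$ of $V$), and $\widetilde{T_{\mathbf K}}\in A_h\hat\otimes V_h^\star$ is the tensor of $T_{\mathbf K}$ under $\mathrm{Hom}_{\mathbf K}(V_h,A_h)\cong A_h\hat\otimes V_h^\star$. $\eta:A\otimes V^*\to(A\oplus V^* )^{\otimes2}$, $a\otimes f\mapsto(a,0)\otimes(0,f)$, and $\eta_h:A_h\hat\otimes V^\star_h\to(A\oplus V^* )_h\hat\otimes(A\oplus V^* )_h$ is the analogous $\mathbf K$-linear embedding. $\sigma$ is the flip, $\sigma_{\mathbf K}$ its $\mathbf K$-linear extension. For $r=\sum_ia_i\otimes b_i$: AYBE is $\mathbf A(r)=\sum_{i,j}\big(a_i\circ a_j\otimes b_i\otimes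 b_j+a_i\otimes a_j\otimes b_i\circ b_j-a_j\otimes a_i\circ b_j\otimes b_i\big)=0$ (same over $\mathbf K$ with $\hat\otimes$); CYBE is $\mathbf C(r)=\sum_{i,j}\big(\{a_i,a_j\}\otimes b_i\otimes b_j+a_i\otimes\{b_i,a_j\}\otimes b_j+a_i\otimes a_j\otimes\{b_i,b_j\}\big)=0$; PYBE is $\mathbf A(r)=\mathbf C(r)=0$. Known background: $r=\eta(\tilde T)-\sigma(\eta(\tilde T))$ solves the AYBE in $A\ltimes_{-\rho_\circ^*}V^*$ iff $T$ is an $\mathcal O$-operator on $(A,\circ)$ associated to $(V,\rho_\circ)$, and analogously over $\mathbf K$ (AYBE, $r_h$, $T_{\mathbf K}$) and for Poisson algebras (PYBE). *)

(* Defs.v *)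
From HB Require Import structures.
From mathcomp Require Import all_boot all_order all_algebra.
From mathcomp Require Import boolp.

Set Implicit Arguments.
Unset Strict Implicit.
Unset Printing Implicit Defensive.

Import GRing.Theory.
Local Open Scope ring_scope.

(* [powser V] is V[[h]]; the series \sum_n v_n h^n is the sequence n |-> v_n. *)
Definition powser (V : Type) := nat -> V.

HB.instance Definition _ (V : Type) := gen_eqMixin (powser V).
HB.instance Definition _ (V : Type) := gen_choiceMixin (powser V).

Lemma powserP (V : Type) (u v : powser V) : (forall n, u n = v n) <-> u = v.
Proof. by split=> [uv|->//]; apply/funext. Qed.

Section PowserZmod.
Variable V : zmodType.
Definition powser_add (u v : powser V) : powser V := fun n => u n + v n.
Definition powser_opp (u : powser V) : powser V := fun n => - u n.
Definition powser_zero : powser V := fun _ => 0.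

Fact powser_addA : associative powser_add.
Proof. by move=> u v w; apply/powserP=> n; apply: addrA. Qed.
Fact powser_addC : commutative powser_add.
Proof. by move=> u v; apply/powserP=> n; apply: addrC. Qed.
Fact powser_add0 : left_id powser_zero powser_add.
Proof. by move=> u; apply/powserP=> n; apply: add0r. Qed.
Fact powser_addN : left_inverse powser_zero powser_opp powser_add.
Proof. by move=> u; apply/powserP=> n; apply: addNr. Qed.

HB.instance Definition _ := GRing.isZmodule.Build (powser V)
  powser_addA powser_addC powser_add0 powser_addN.

Definition cst (v : V) : powser V := fun n => if n == 0%N then v else 0.

Lemma powserD (u v : powser V) n : (u + v) n = u n + v n. Proof. by []. Qed.
Lemma powserN (u : powser V) n : (- u) n = - u n. Proof. by []. Qed.
Lemma powser0 n : (0 : powser V) n = 0. Proof. by []. Qed.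
Lemma powser_sum (I : Type) (r : seq I) (P : pred I) (F : I -> powser V) n :
  (\sum_(i <- r | P i) F i) n = \sum_(i <- r | P i) F i n.
Proof. by elim/big_rec2: _ => // i x y _ <-. Qed.
End PowserZmod.

(* The scalar extension of f, applied coefficientwise. *)
Definition powmap (U V : Type) (f : U -> V) (u : powser U) : powser V :=
  fun n => f (u n).

(* The h-adically continuous bilinear extension of f. *)
Definition cauchy (U V : Type) (W : zmodType) (f : U -> V -> W)
    (u : powser U) (v : powser V) : powser W :=
  fun n => \sum_(i < n.+1) f (u i) (v (n - i)%N).

Lemma cauchy_rev (U V : Type) (W : zmodType) (f : U -> V -> W) u v n :
  cauchy f u v n = \sum_(i < n.+1) f (u (n - i)%N) (v i).
Proof.
rewrite /cauchy (reindex_inj rev_ord_inj) /=; apply: eq_bigr => i _.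
by rewrite (sub_ordK i).
Qed.

Section CauchyAssoc.
Variables (U V W UV VW Z : zmodType).
Variables (f : U -> V -> UV) (g : UV -> W -> Z).
Variables (f' : V -> W -> VW) (g' : U -> VW -> Z).
Hypothesis gD : forall w, {morph g ^~ w : x y / x + y}.
Hypothesis g0 : forall w, g 0 w = 0.
Hypothesis g'D : forall u, {morph g' u : x y / x + y}.
Hypothesis g'0 : forall u, g' u 0 = 0.
Hypothesis fg : forall u v w, g' u (f' v w) = g (f u v) w.

Lemma cauchyA u v w : cauchy g' u (cauchy f' v w) = cauchy g (cauchy f u v) w.
Proof.
apply/powserP => n; rewrite [RHS]cauchy_rev.
change (\sum_(j < n.+1) g' (u j) (cauchy f' v w (n - j)%N) =
        \sum_(k < n.+1) g (cauchy f u v (n - k)%N) (w k)).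
pose c j k := g' (u j) (f' (v (n - j - k)%N) (w k)).
transitivity (\sum_(j < n.+1) \sum_(k < n.+1 | (k <= n - j)%N) c j k).
  apply: eq_bigr => /= j _; rewrite cauchy_rev.
  rewrite (big_morph (g' (u j)) (g'D (u j)) (g'0 _)).
  by rewrite (big_ord_narrow_leq (leq_subr _ _)).
rewrite (exchange_big_dep predT) //=; apply: eq_bigr => k _.
transitivity (\sum_(j < n.+1 | (j <= n - k)%N) c j k).
  apply: eq_bigl => j; rewrite -ltnS -(ltnS j) -!subSn ?leq_ord //.
  by rewrite -subn_gt0 -(subn_gt0 j) -!subnDA addnC.
rewrite (big_ord_narrow_leq (leq_subr _ _)).
rewrite /cauchy (big_morph (g ^~ (w k)) (gD (w k)) (g0 _)).
by apply: eq_bigr => j _; rewrite /c -!subnDA addnC fg.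
Qed.
End CauchyAssoc.

Section PowserRing.
Variable k : comNzRingType.

Definition powser_one : powser k := cst 1.
Definition powser_mul : powser k -> powser k -> powser k := cauchy *%R.

Fact powser_mulA : associative powser_mul.
Proof.
move=> a b c; apply: cauchyA => *; rewrite ?mulr0 ?mul0r //.
- by move=> ? ?; rewrite mulrDl.
- by move=> ? ?; rewrite mulrDr.
- by rewrite mulrA.
Qed.
Fact powser_mulC : commutative powser_mul.
Proof.
move=> a b; apply/powserP => n; rewrite /powser_mul cauchy_rev.
by apply: eq_bigr => i _; rewrite mulrC.
Qed.
Fact powser_mul1 : left_id powser_one powser_mul.
Proof.
move=> a; apply/powserP => n; rewrite /powser_mul /cauchy big_ord_recl /=.
by rewrite mul1r subn0 big1 ?addr0 // => i _; rewrite mul0r.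
Qed.
Fact powser_mulDl : left_distributive powser_mul +%R.
Proof.
move=> a b c; apply/powserP => n; rewrite /powser_mul /cauchy powserD.
by rewrite -big_split; apply: eq_bigr => i _; rewrite mulrDl.
Qed.
Fact powser_one_neq0 : powser_one != 0.
Proof.
by apply/eqP => /powserP/(_ 0%N)/eqP; rewrite powser0 /powser_one /cst oner_eq0.
Qed.

HB.instance Definition _ := GRing.Zmodule_isComNzRing.Build (powser k)
  powser_mulA powser_mulC powser_mul1 powser_mulDl powser_one_neq0.

Definition hvar : powser k := fun n => (n == 1%N)%:R.

Variable V : lmodType k.
Definition powser_scale : powser k -> powser V -> powser V := cauchy *:%R.

Fact powser_scaleA a b (v : powser V) :
  powser_scale a (powser_scale b v) = powser_scale (a * b) v.
Proof.
apply: cauchyA => *; rewrite ?scale0r ?scaler0 ?scalerA //.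
- by move=> ? ?; rewrite scalerDl.
- by move=> ? ?; rewrite scalerDr.
Qed.
Fact powser_scale1 : left_id 1 powser_scale.
Proof.
move=> a; apply/powserP => n; rewrite /powser_scale /cauchy big_ord_recl /=.
by rewrite scale1r subn0 big1 ?addr0 // => i _; rewrite scale0r.
Qed.
Fact powser_scaleDr : right_distributive powser_scale +%R.
Proof.
move=> a b c; apply/powserP => n; rewrite /powser_scale /cauchy powserD.
by rewrite -big_split; apply: eq_bigr => i _; rewrite scalerDr.
Qed.
Fact powser_scaleDl v : {morph powser_scale^~ v : a b / a + b}.
Proof.
move=> a b; apply/powserP => n; rewrite /powser_scale /cauchy powserD.
by rewrite -big_split; apply: eq_bigr => i _; rewrite scalerDl.
Qed.

HB.instance Definition _ := GRing.Zmodule_isLmodule.Build (powser k) (powser V)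
  powser_scaleA powser_scale1 powser_scaleDr powser_scaleDl.

Lemma powserZ (a : powser k) (v : powser V) n :
  (a *: v) n = \sum_(i < n.+1) a i *: v (n - i)%N.
Proof. by []. Qed.

Lemma hvarZ0 (v : powser V) : (hvar *: v) 0%N = 0.
Proof. by rewrite powserZ big_ord1 scale0r. Qed.
Lemma hvarZS (v : powser V) n : (hvar *: v) n.+1 = v n.
Proof.
rewrite powserZ 2!big_ord_recl /= scale0r scale1r add0r subn1.
by rewrite big1 ?addr0 // => i _; rewrite scale0r.
Qed.

(* u = x mod h, for u in V[[h]] and x in V *)
Definition eqmodh (u : powser V) (x : V) : Prop :=
  exists w : powser V, u = cst x + hvar *: w.

(* (u - v) / h = x mod h *)
Definition eqmodh_quot (u v : powser V) (x : V) : Prop :=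
  exists w : powser V, u - v = hvar *: w /\ eqmodh w x.

Lemma eqmodhP u x : eqmodh u x <-> u 0%N = x.
Proof.
split=> [[w ->]|<-]; first by rewrite powserD hvarZ0 addr0.
exists (fun n => u n.+1); apply/powserP => -[|n]; rewrite powserD.
  by rewrite hvarZ0 addr0.
by rewrite hvarZS add0r.
Qed.

Lemma eqmodh_quotP u v x : eqmodh_quot u v x <-> u 0%N = v 0%N /\ u 1%N - v 1%N = x.
Proof.
split=> [[w [uv /eqmodhP<-]]|[uv0 uv1]].
  split; last by rewrite -[LHS]/((u - v) 1%N) uv hvarZS.
  by apply/eqP; rewrite -subr_eq0 -[_ - _]/((u - v) 0%N) uv hvarZ0.
exists (fun n => u n.+1 - v n.+1); split; last exact/eqmodhP.
apply/powserP => -[|n]; last by rewrite hvarZS.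
by rewrite hvarZ0 powserD powserN uv0 subrr.
Qed.

End PowserRing.

Notation bilin f := (bilinear_for *:%R *:%R f).

Section CauchyBilinear.
Variables (k : comNzRingType) (U V W : lmodType k) (f : U -> V -> W).

Lemma cauchy_bilin : bilin f -> bilin (cauchy f).
Proof.
move=> [fl fr].
have fDl v : {morph f^~ v : x y / x + y}.
  by move=> x y /=; have /= := fl v 1 x y; rewrite !scale1r.
have fDr u : {morph f u : x y / x + y}.
  by move=> x y /=; have /= := fr u 1 x y; rewrite !scale1r.
have f0l v : f 0 v = 0 by apply: (addIr (f 0 v)); rewrite -fDl !add0r.
have f0r u : f u 0 = 0 by apply: (addIr (f u 0)); rewrite -fDr !add0r.
have fZl v a x : f (a *: x) v = a *: f x v.
  by have := fl v a x 0; rewrite !addr0 f0l addr0.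
have fZr u a y : f u (a *: y) = a *: f u y.
  by have := fr u a y 0; rewrite !addr0 f0r addr0.
have hDl v : {morph (cauchy f)^~ v : x y / x + y}.
  move=> x y; apply/powserP => n; rewrite powserD -big_split.
  by apply: eq_bigr => i _; rewrite powserD fDl.
have hDr u : {morph cauchy f u : x y / x + y}.
  move=> x y; apply/powserP => n; rewrite powserD -big_split.
  by apply: eq_bigr => i _; rewrite powserD fDr.
split=> [v|u] a x y; [rewrite hDl|rewrite hDr]; congr (_ + _).
  symmetry; apply: cauchyA => *; rewrite ?f0l ?scaler0 ?fZl //.
  by move=> ? ?; rewrite scalerDr.
apply/powserP => n.
transitivity (cauchy (fun z u => f u z) (a *: x) u n).
  by rewrite [RHS]cauchy_rev.
transitivity ((a *: cauchy (fun z u => f u z) x u) n); last first.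
  by rewrite !powserZ; apply: eq_bigr => i _; rewrite cauchy_rev.
congr (_ n); symmetry; apply: cauchyA => *; rewrite ?f0r ?scaler0 ?fZr //.
by move=> ? ?; rewrite scalerDr.
Qed.
End CauchyBilinear.

Section Algebras.
Variables (R : comNzRingType) (A : lmodType R).
Implicit Types (mul br : A -> A -> A).

Definition assoc_alg mul : Prop := bilin mul /\ associative mul.

Definition comm_assoc_alg mul : Prop := assoc_alg mul /\ commutative mul.

Definition poisson_alg br mul : Prop :=
  [/\ comm_assoc_alg mul, bilin br, forall x, br x x = 0,
      forall x y z, br x (br y z) + br y (br z x) + br z (br x y) = 0
    & forall x y z, br x (mul y z) = mul (br x y) z + mul y (br x z)].

End Algebras.

Section Modules.
Variables (R : comNzRingType) (A V : lmodType R).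
Implicit Types (mul br : A -> A -> A) (l r rho rb : A -> V -> V).

(* product of the semidirect product of A and the bimodule (V, l, r) *)
Definition sd_mul mul l r (p q : A * V) : A * V :=
  (mul p.1 q.1, l p.1 q.2 + r q.1 p.2).

(* bracket of the semidirect product of a Poisson algebra and a module *)
Definition sd_br br rho (p q : A * V) : A * V :=
  (br p.1 q.1, rho p.1 q.2 - rho q.1 p.2).

Definition bimodule mul l r : Prop :=
  [/\ bilin l, bilin r & assoc_alg (sd_mul mul l r)].

Definition opp_act rho : A -> V -> V := fun x u => - rho x u.

Definition oop mul l r (T : V -> A) : Prop :=
  forall u v, mul (T u) (T v) = T (l (T u) v) + T (r (T v) u).

Definition poisson_oop br mul rb rho (T : V -> A) : Prop :=
  oop mul rho rho T /\
  (forall u v, br (T u) (T v) = T (rb (T u) v) - T (rb (T v) u)).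

End Modules.

Section Deformations.
Variables (k : fieldType) (A : lmodType k).
Implicit Types mulh : powser A -> powser A -> powser A.

Definition assoc_deformation (mul : A -> A -> A) mulh : Prop :=
  assoc_alg mulh /\ forall x y, eqmodh (mulh (cst x) (cst y)) (mul x y).

Definition qcl mulh (br : A -> A -> A) : Prop :=
  forall x y,
    eqmodh_quot (mulh (cst x) (cst y)) (mulh (cst y) (cst x)) (br x y).

End Deformations.

Section ModuleDeformations.
Variables (k : fieldType) (A V : lmodType k).
Implicit Types (mulh : powser A -> powser A -> powser A).
Implicit Types (lh rh : powser A -> powser V -> powser V).

(* the identification of A_h (+) V_h with (A (+) V)_h *)
Definition hpair (p : powser A * powser V) : powser (A * V) :=
  fun n => (p.1 n, p.2 n).
Definition hunpair (p : powser (A * V)) : powser A * powser V :=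
  (powmap fst p, powmap snd p).

Definition hsd_mul mulh lh rh (p q : powser (A * V)) : powser (A * V) :=
  hpair (sd_mul mulh lh rh (hunpair p) (hunpair q)).

Definition bimodule_deformation mul l r mulh lh rh : Prop :=
  bimodule mulh lh rh /\
  assoc_deformation (sd_mul mul l r) (hsd_mul mulh lh rh).

Definition qcl_module lh rh (rho : A -> V -> V) : Prop :=
  forall x u,
    eqmodh_quot (lh (cst x) (cst u)) (rh (cst x) (cst u)) (rho x u).

End ModuleDeformations.

Notation tdim V := (\dim {:V}%VS).

Section Tensor.
Variable k : fieldType.

Definition tbasis (V : vectType k) (i : 'I_(tdim V)) : V := (vbasis {:V}%VS)`_i.

Definition tcoord (V : vectType k) (i : 'I_(tdim V)) (v : V) : k^o :=
  coord (vbasis {:V}%VS) i v.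

Fact tcoord_linear (V : vectType k) (i : 'I_(tdim V)) : linear (@tcoord V i).
Proof. by move=> a v w; rewrite /tcoord linearP. Qed.
HB.instance Definition _ (V : vectType k) (i : 'I_(tdim V)) :=
  GRing.isLinear.Build k V k^o *:%R (@tcoord V i) (@tcoord_linear V i).

(* V (x) W for finite-dimensional V and W, in coordinates with respect to the
   bases [tbasis V] and [tbasis W]; see [tens_bilin], [tlift_tens] and
   [tlift_unique] for the universal property. *)
Definition tensor (V W : vectType k) := 'M[k]_(tdim V, tdim W).
HB.instance Definition _ (V W : vectType k) :=
  Vector.copy (tensor V W) 'M[k]_(tdim V, tdim W).

Definition tens (V W : vectType k) (v : V) (w : W) : tensor V W :=
  \matrix_(i, j) (tcoord i v * tcoord j w).

Definition dual (V : vectType k) : vectType k := 'Hom(V, k^o).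

Definition dual_tbasis (V : vectType k) (i : 'I_(tdim V)) : dual V :=
  linfun (@tcoord V i).

(* the linear map on V (x) W induced by a bilinear map f *)
Definition tlift (V W : vectType k) (Z : lmodType k) (f : V -> W -> Z)
    (t : tensor V W) : Z :=
  \sum_i \sum_j t i j *: f (tbasis i) (tbasis j).

Lemma tbasis_expand (V : vectType k) (v : V) : v = \sum_i tcoord i v *: tbasis i.
Proof. by rewrite {1}(coord_vbasis (memvf v)). Qed.

Lemma tcoord_tbasis (V : vectType k) (i j : 'I_(tdim V)) : tcoord i (tbasis j) = (i == j)%:R :> k.
Proof. by rewrite /tcoord coord_free ?(basis_free (vbasisP _)) // eq_sym. Qed.

Section TensorTheory.
Variables V W : vectType k.

Lemma tens_bilin : bilin (@tens V W).
Proof.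
split=> [w|v] a x y; apply/matrixP => i j; rewrite !mxE tcoord_linear.
  by rewrite [LHS]mulrDl mulrA.
by rewrite [LHS]mulrDr mulrCA.
Qed.

Lemma tens_tbasis i j : tens (tbasis i) (tbasis j) = delta_mx i j :> tensor V W.
Proof.
apply/matrixP => p q; by rewrite !mxE !tcoord_tbasis -natrM mulnb.
Qed.

Lemma tensor_expand (t : tensor V W) :
  t = \sum_i \sum_j t i j *: tens (tbasis i) (tbasis j).
Proof.
rewrite [LHS]matrix_sum_delta; apply: eq_bigr => i _; apply: eq_bigr => j _.
by rewrite tens_tbasis.
Qed.

Section Lift.
Variables (Z : lmodType k) (f : V -> W -> Z).

Lemma tlift_linear : linear (tlift f).
Proof.
move=> a s t; rewrite /tlift scaler_sumr -big_split; apply: eq_bigr => i _.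
rewrite scaler_sumr -big_split; apply: eq_bigr => j _ /=.
by rewrite !mxE scalerDl scalerA.
Qed.

Lemma tlift_tens : bilin f -> forall v w, tlift f (tens v w) = f v w.
Proof.
move=> [fl fr] v w.
pose L w := GRing.isLinear.Build _ _ _ _ (f^~ w) (fl w).
pose R v := GRing.isLinear.Build _ _ _ _ (f v) (fr v).
pose Lw : {linear V -> Z} := HB.pack (f^~ w) (L w).
have -> : f v w = Lw v by [].
rewrite [in RHS](tbasis_expand v) linear_sum; apply: eq_bigr => i _.
rewrite linearZ /=.
pose Rv : {linear W -> Z} := HB.pack (f (tbasis i)) (R (tbasis i)).
have -> : f (tbasis i) w = Rv w by [].
rewrite [in RHS](tbasis_expand w) linear_sum scaler_sumr; apply: eq_bigr => j _.
by rewrite linearZ /= scalerA mxE.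
Qed.

Lemma tlift_unique (g : tensor V W -> Z) :
  linear g -> (forall v w, g (tens v w) = f v w) -> g =1 tlift f.
Proof.
move=> gl gf t.
pose G : {linear tensor V W -> Z} :=
  HB.pack g (GRing.isLinear.Build _ _ _ _ g gl).
have -> : g t = G t by [].
rewrite {1}(tensor_expand t) linear_sum; apply: eq_bigr => i _.
by rewrite linear_sum; apply: eq_bigr => j _; rewrite linearZ /= gf.
Qed.
End Lift.
End TensorTheory.

(* The completed tensor product of V_h and W_h is powser (tensor V W). *)
Definition htens (V W : vectType k) : powser V -> powser W -> powser (tensor V W) :=
  cauchy (@tens V W).

(* the K-linear map on the completed tensor product induced by a K-bilinear
   map f; n |-> t n i j is the coordinate of t in k[[h]] *)
Definition hlift (V W : vectType k) (Z : lmodType (powser k))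
    (f : powser V -> powser W -> Z) (t : powser (tensor V W)) : Z :=
  \sum_i \sum_j
    ((fun n => t n i j) : powser k) *: f (cst (tbasis i)) (cst (tbasis j)).

Lemma powser_expand (V : vectType k) (v : powser V) :
  v = \sum_i (powmap (@tcoord V i) v : powser k) *: cst (tbasis i).
Proof.
apply/powserP => n; rewrite powser_sum {1}[v n]tbasis_expand.
apply: eq_bigr => i _; rewrite powserZ big_ord_recr /= subnn big1 ?add0r // => m _.
by rewrite /cst subn_eq0 leqNgt ltn_ord /= scaler0.
Qed.

Section CompletedTensorTheory.
Variables V W : vectType k.

Lemma htens_bilin : bilin (@htens V W).
Proof. exact/cauchy_bilin/tens_bilin. Qed.

Lemma hlift_htens (Z : lmodType (powser k)) (f : powser V -> powser W -> Z) :
  bilin f -> forall v w, hlift f (htens v w) = f v w.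
Proof.
move=> [fl fr] v w.
pose L w := GRing.isLinear.Build _ _ _ _ (f^~ w) (fl w).
pose R v := GRing.isLinear.Build _ _ _ _ (f v) (fr v).
pose Lw : {linear powser V -> Z} := HB.pack (f^~ w) (L w).
have -> : f v w = Lw v by [].
rewrite [in RHS](powser_expand v) linear_sum; apply: eq_bigr => i _.
rewrite linearZ /=.
pose Rv : {linear powser W -> Z} := HB.pack (f (cst (tbasis i))) (R _).
have -> : f (cst (tbasis i)) w = Rv w by [].
rewrite [in RHS](powser_expand w) linear_sum scaler_sumr; apply: eq_bigr => j _.
rewrite linearZ /= scalerA; congr (_ *: _); apply/powserP => n.
by rewrite /htens /cauchy summxE; apply: eq_bigr => m _; rewrite mxE.
Qed.
End CompletedTensorTheory.

Definition flip (V W : vectType k) : tensor V W -> tensor W V :=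
  tlift (fun v w => tens w v).

(* the tensors of linear maps V -> A and V_h -> A_h *)
Definition tilde (V A : vectType k) (T : V -> A) : tensor A (dual V) :=
  \sum_i tens (T (tbasis i)) (dual_tbasis i).
Definition htilde (V A : vectType k) (T : powser V -> powser A) :
    powser (tensor A (dual V)) :=
  \sum_i htens (T (cst (tbasis i))) (cst (dual_tbasis i)).

Lemma dual_lfunP (V : vectType k) (c : k) (f g : dual V) (v : V) :
  (c *: f + g) v = c * f v + g v :> k.
Proof. by rewrite [LHS]add_lfunE scale_lfunE. Qed.

Lemma dual_tbasisE (V : vectType k) (i : 'I_(tdim V)) (v : V) :
  dual_tbasis i v = tcoord i v.
Proof. exact: lfunE. Qed.

Lemma tildeK (V A : vectType k) (T : 'Hom(V, A)) (u : V) :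
  tlift (fun (a : A) (f : dual V) => (f u : k) *: a) (tilde T) = T u.
Proof.
set g := fun a f => _.
have gb : bilin g.
  split=> [f|a] c x y; rewrite /g /=.
    by rewrite scalerDr !scalerA mulrC.
  by rewrite dual_lfunP scalerDl scalerA.
pose G : {linear tensor A (dual V) -> A} :=
  HB.pack (tlift g) (GRing.isLinear.Build _ _ _ _ _ (@tlift_linear _ _ _ g)).
have -> : tlift g (tilde T) = G (tilde T) by [].
rewrite [in RHS](tbasis_expand u) !linear_sum; apply: eq_bigr => i _ /=.
by rewrite tlift_tens // /g dual_tbasisE linearZ.
Qed.

Definition eta (A W : vectType k) : tensor A W -> tensor (A * W)%type (A * W)%type :=
  tlift (fun (a : A) (f : W) => tens ((a, 0) : A * W) ((0, f) : A * W)).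
Definition etah (A W : vectType k) :
    powser (tensor A W) -> powser (tensor (A * W)%type (A * W)%type) :=
  hlift (fun (a : powser A) (f : powser W) =>
    htens (hpair (a, 0)) (hpair (0, f))).

Definition rtensor (V A : vectType k) (T : V -> A) :
    tensor (A * dual V)%type (A * dual V)%type :=
  eta (tilde T) - flip (eta (tilde T)).
Definition rtensorh (V A : vectType k) (T : powser V -> powser A) :
    powser (tensor (A * dual V)%type (A * dual V)%type) :=
  etah (htilde T) - powmap (@flip _ _) (etah (htilde T)).

Section YangBaxter.
Variable B : vectType k.
Implicit Types (mul br : B -> B -> B) (r : tensor B B).

Definition tens3 (a b c : B) : tensor (tensor B B) B := tens (tens a b) c.
Definition htens3 (a b c : powser B) : powser (tensor (tensor B B) B) :=
  htens (htens a b) c.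

Definition ayb mul r : tensor (tensor B B) B :=
  tlift (fun a b => tlift (fun a' b' =>
    tens3 (mul a a') b b' + tens3 a a' (mul b b') - tens3 a' (mul a b') b) r) r.
Definition hayb (mulh : powser B -> powser B -> powser B)
    (r : powser (tensor B B)) : powser (tensor (tensor B B) B) :=
  hlift (fun a b => hlift (fun a' b' =>
    htens3 (mulh a a') b b' + htens3 a a' (mulh b b')
    - htens3 a' (mulh a b') b) r) r.
Definition cyb br r : tensor (tensor B B) B :=
  tlift (fun a b => tlift (fun a' b' =>
    tens3 (br a a') b b' + tens3 a (br b a') b' + tens3 a a' (br b b')) r) r.

Definition skew_aybe_sol mul r : Prop := flip r = - r /\ ayb mul r = 0.
Definition skew_haybe_sol mulh (r : powser (tensor B B)) : Prop :=
  powmap (@flip B B) r = - r /\ hayb mulh r = 0.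
Definition skew_pybe_sol br mul r : Prop :=
  [/\ flip r = - r, ayb mul r = 0 & cyb br r = 0].
End YangBaxter.

Section Duals.
Variables A V : vectType k.

Definition dual_act (rho : A -> V -> V) : A -> dual V -> dual V :=
  fun x f => linfun (fun v => - f (rho x v)).

(* V_h^* is powser (dual V). *)
Definition hpairing : powser (dual V) -> powser V -> powser k :=
  cauchy (fun (f : dual V) (v : V) => f v).

Lemma dual_actP rho : bilin rho -> forall x (f : dual V) v,
  (dual_act rho x f) v = - f (rho x v).
Proof.
move=> [_ rr] x f v; rewrite /dual_act; pose g v : k^o := - f (rho x v).
have gl : linear g.
  by move=> a y z; rewrite /g rr linearP opprD scalerN.
pose G : {linear V -> k^o} := HB.pack g (GRing.isLinear.Build _ _ _ _ g gl).
exact: (lfunE G).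
Qed.

(* By K-linearity it is enough to prescribe the values on V; see
   [hdual_actP]. *)
Definition hdual_act (rhoh : powser A -> powser V -> powser V) :
    powser A -> powser (dual V) -> powser (dual V) :=
  fun x f n => linfun (fun v : V => - hpairing f (rhoh x (cst v)) n : k^o).

Lemma hdual_actP rhoh : bilin rhoh -> forall x (f : powser (dual V)) v,
  hpairing (hdual_act rhoh x f) v = - hpairing f (rhoh x v).
Proof.
move=> [_ rr] x f v.
have pb : bilin (fun (f : dual V) (v : V) => f v).
  split=> [w|g] a y z /=; last by rewrite linearP.
  exact: dual_lfunP.
pose l (v : powser V) : powser k^o := hpairing f (rhoh x v).
have ll : linear l.
  by move=> a y z; rewrite /l rr; apply: (cauchy_bilin pb).2.
pose L : {linear powser V -> powser k^o} :=
  HB.pack l (GRing.isLinear.Build _ _ _ _ l ll).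
have cstL n : linear (fun v => - L (cst v) n : k^o).
  move=> a y z.
  have -> : cst (a *: y + z) = (cst a : powser k) *: cst y + cst z.
    apply/powserP => m; rewrite powserD powserZ big_ord_recl /= big1 ?addr0.
      by rewrite subn0 /cst; case: eqP; rewrite ?scaler0 ?addr0.
    by move=> i _; rewrite scale0r.
  rewrite linearP powserD powserZ big_ord_recl /= big1 ?addr0.
    by rewrite subn0 opprD scalerN.
  by move=> i _; rewrite scale0r.
pose C n : {linear V -> k^o} :=
  HB.pack (fun v => - L (cst v) n : k^o)
    (GRing.isLinear.Build _ _ _ _ _ (cstL n)).
have CE n w : hdual_act rhoh x f n w = C n w by apply: (lfunE (C n)).
apply/powserP => n; rewrite powserN -[hpairing f _]/(L v).
rewrite {2}(powser_expand v) linear_sum powser_sum -sumrN.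
transitivity (\sum_(i < n.+1) \sum_b tcoord b (v (n - i)%N) * C i (tbasis b)).
  apply: eq_bigr => i _; rewrite CE {1}(tbasis_expand (v _)) linear_sum.
  by apply: eq_bigr => b _; rewrite linearZ.
rewrite exchange_big; apply: eq_bigr => b _.
rewrite linearZ /= [X in _ = - X]powserZ -sumrN [RHS](reindex_inj rev_ord_inj) /=.
by apply: eq_bigr => i _; rewrite subSS (sub_ordK i); apply: mulrN.
Qed.
End Duals.

End Tensor.

(* Main.v *)
(* Write <f, v> for the pairing between V^* and V, over k or over K. Everything
   rests on adjunction: the dual actions x.f = f o r(x) and f.x = f o l(x) turn
   the bimodule axioms of (V, l, r) into those of the dual. The bracket of
   A |x V^* is the h-coefficient of the commutator in A_h |x V_h^*; since that
   commutator vanishes mod h, the Jacobi and Leibniz identities of the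
   quasiclassical limit are the h^2- and h-coefficients of the corresponding
   commutator identities in an associative algebra.

   For dual bases (e_i) and (f_i), adjunction gives
   \sum_i T e_i (x) (f_i o phi) = \sum_i T (phi e_i) (x) f_i. Splitting A(r)
   according to which of its three tensor factors lies in A, this identity
   rewrites each part so that it vanishes by the O-operator equation. The
   argument uses no associativity, so it also applies to the bracket, for which
   C(r) and A(r) agree by antisymmetry. *)
From HB Require Import structures.
Require Import Defs.
From mathcomp Require Import all_boot all_order all_algebra.
From mathcomp Require Import boolp.

Set Implicit Arguments.
Unset Strict Implicit.
Unset Printing Implicit Defensive.

Import GRing.Theory.
Local Open Scope ring_scope.

(** * Calculus of bilinear maps and bimodules over a commutative ring *)

Section Bilinear.
Variables (R : comNzRingType) (U V W : lmodType R) (f : U -> V -> W).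
Hypothesis f_bilin : bilin f.

Lemma bilinPl a x y v : f (a *: x + y) v = a *: f x v + f y v.
Proof. exact: f_bilin.1. Qed.
Lemma bilinPr u a x y : f u (a *: x + y) = a *: f u x + f u y.
Proof. exact: f_bilin.2. Qed.
Lemma bilinDl x y v : f (x + y) v = f x v + f y v.
Proof. by have /= := f_bilin.1 v 1 x y; rewrite !scale1r. Qed.
Lemma bilinDr u x y : f u (x + y) = f u x + f u y.
Proof. by have /= := f_bilin.2 u 1 x y; rewrite !scale1r. Qed.
Lemma bilin0l v : f 0 v = 0.
Proof. by apply: (addIr (f 0 v)); rewrite -bilinDl !add0r. Qed.
Lemma bilin0r u : f u 0 = 0.
Proof. by apply: (addIr (f u 0)); rewrite -bilinDr !add0r. Qed.
Lemma bilinZl a x v : f (a *: x) v = a *: f x v.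
Proof. by have /= := f_bilin.1 v a x 0; rewrite !addr0 bilin0l addr0. Qed.
Lemma bilinZr a u y : f u (a *: y) = a *: f u y.
Proof. by have /= := f_bilin.2 u a y 0; rewrite !addr0 bilin0r addr0. Qed.
Lemma bilinNl x v : f (- x) v = - f x v.
Proof. by rewrite -!scaleN1r bilinZl. Qed.
Lemma bilinNr u y : f u (- y) = - f u y.
Proof. by rewrite -!scaleN1r bilinZr. Qed.
Lemma bilin_suml (I : finType) (x : I -> U) v :
  f (\sum_i x i) v = \sum_i f (x i) v.
Proof. by apply: (big_morph (f^~ v)) => [? ?|]; rewrite ?bilinDl ?bilin0l. Qed.
Lemma bilin_sumr (I : finType) u (y : I -> V) :
  f u (\sum_i y i) = \sum_i f u (y i).
Proof. by apply: (big_morph (f u)) => [? ?|]; rewrite ?bilinDr ?bilin0r. Qed.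
End Bilinear.

Section BilinearClosure.
Variables (R : comNzRingType) (U V W : lmodType R).
Implicit Types f g : U -> V -> W.

Lemma bilin_add f g : bilin f -> bilin g -> bilin (fun x y => f x y + g x y).
Proof.
by move=> fb gb; split=> [v|u] a x y /=;
  rewrite ?(bilinPl fb) ?(bilinPl gb) ?(bilinPr fb) ?(bilinPr gb);
  rewrite scalerDr addrACA.
Qed.

Lemma bilin_opp f : bilin f -> bilin (fun x y => - f x y).
Proof.
by move=> fb; split=> [v|u] a x y /=;
  rewrite ?(bilinPl fb) ?(bilinPr fb) opprD scalerN.
Qed.

Lemma bilin_sum (I : finType) (F : I -> U -> V -> W) :
  (forall i, bilin (F i)) -> bilin (fun x y => \sum_i F i x y).
Proof.
move=> Fb; split=> [v|u] a x y /=; rewrite scaler_sumr -big_split;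
  by apply: eq_bigr => i _; rewrite ?(bilinPl (Fb i)) ?(bilinPr (Fb i)).
Qed.

Lemma bilin_comp (U' V' : lmodType R) f (p : U' -> U) (q : V' -> V) :
  linear p -> linear q -> bilin f -> bilin (fun x y => f (p x) (q y)).
Proof.
by move=> pl ql fb; split=> [v|u] a x y /=;
  rewrite ?pl ?ql ?(bilinPl fb) ?(bilinPr fb).
Qed.

Lemma bilin_swap f : bilin f -> bilin (fun y x => f x y).
Proof. by case. Qed.

Lemma bilin_postcomp (Z : lmodType R) f (p : W -> Z) :
  linear p -> bilin f -> bilin (fun x y => p (f x y)).
Proof.
by move=> pl fb; split=> [v|u] a x y /=; rewrite ?(bilinPl fb) ?(bilinPr fb) pl.
Qed.

Lemma linear_id : linear (fun u : U => u). Proof. by []. Qed.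
End BilinearClosure.

Lemma sd_mul_bilin (R : comNzRingType) (A V : lmodType R)
    (mul : A -> A -> A) (l r : A -> V -> V) :
  bilin mul -> bilin l -> bilin r -> bilin (sd_mul mul l r).
Proof.
move=> mb lb rb; split=> [[v v']|[u u']] a [x x'] [y y'];
  rewrite /sd_mul /=; congr (_, _) => /=.
- exact: bilinPl.
- by rewrite (bilinPl lb) (bilinPr rb) scalerDr addrACA.
- exact: bilinPr.
- by rewrite (bilinPr lb) (bilinPl rb) scalerDr addrACA.
Qed.

(** Products of two elements of V vanish in the semidirect product, so associativity only has to be
    tested on triples with at most one entry in V. The position of that entry (last, first, middle)
    gives the three action axioms. *)
Lemma bimoduleP (R : comNzRingType) (A V : lmodType R)
    (mul : A -> A -> A) (l r : A -> V -> V) :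
  bimodule mul l r <->
  [/\ assoc_alg mul, bilin l, bilin r
    & [/\ forall x y v, l (mul x y) v = l x (l y v),
          forall x y v, r (mul x y) v = r y (r x v)
        & forall x y v, l x (r y v) = r y (l x v)]].
Proof.
split=> [[lb rb [mb mA]]|[[mb mA] lb rb [lM rM lr]]].
  have mA' x u y v z w := mA (x, u) (y, v) (z, w).
  have simp := (bilin0l lb, bilin0l rb, bilin0r lb, bilin0r rb, addr0, add0r).
  split=> //.
    split=> [|x y z]; last by have [] := mA' x 0 y 0 z 0.
    split=> [v|u] a x y.
      by have /= := f_equal fst (bilinPl mb a (x, 0) (y, 0) (v, 0)).
    by have /= := f_equal fst (bilinPr mb (u, 0) a (x, 0) (y, 0)).
  split=> x y v.
  - have [_] := mA' x 0 y 0 0 v.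
    by rewrite /= !simp.
  - have [_] := mA' 0 v x 0 y 0.
    by rewrite /= !simp.
  - have [_] := mA' x 0 0 v y 0.
    by rewrite /= !simp.
split=> //; split; first exact: sd_mul_bilin.
move=> [x u] [y v] [z w]; rewrite /sd_mul /= mA; congr (_, _).
by rewrite (bilinDr lb) (bilinDr rb) lM rM lr addrA.
Qed.

(** * Dual bimodules for an abstract nondegenerate pairing, to serve over both k and K *)

Section DualBimodule.
Variables (R : comNzRingType) (A V W : lmodType R).
Variables (pair : W -> V -> R) (mul : A -> A -> A) (l r : A -> V -> V).
Hypothesis pair_bilin : bilin (pair : W -> V -> R^o).
Hypothesis pair_inj : forall f g, pair f =1 pair g -> f = g.
Variables ls rs : A -> W -> W.
Hypothesis lsP : forall x f v, pair (ls x f) v = pair f (r x v).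
Hypothesis rsP : forall x f v, pair (rs x f) v = pair f (l x v).

Lemma adjoint_bilin (m : A -> V -> V) (ms : A -> W -> W) :
  (forall x f v, pair (ms x f) v = pair f (m x v)) -> bilin m -> bilin ms.
Proof.
move=> msP mb; split=> [f|x] a y z; apply: pair_inj => v.
  by rewrite (bilinPl pair_bilin) !msP (bilinPl mb) (bilinPr pair_bilin).
by rewrite (bilinPl pair_bilin) !msP (bilinPl pair_bilin).
Qed.

(** Taking adjoints reverses composition: the axiom for [r] becomes the one for [ls], the axiom for
    [l] the one for [rs], and the commutation of the two actions is self-dual. *)
Lemma dual_bimodule : bimodule mul l r -> bimodule mul ls rs.
Proof.
move=> /bimoduleP[mA lb rb [lM rM lr]]; apply/bimoduleP.
split=> //; [exact: adjoint_bilin rb|exact: adjoint_bilin lb|].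
split=> x y f; apply: pair_inj => v.
- by rewrite !lsP rM.
- by rewrite !rsP lM.
- by rewrite rsP !lsP rsP lr.
Qed.
End DualBimodule.

(** * From O-operators to the Yang-Baxter equation, in terms of dual bases *)

Section DualBases.
Variables (R : comNzRingType) (A V W Z : lmodType R) (I : finType).
Variables (pair : W -> V -> R) (e : I -> V) (f : I -> W).
Hypothesis e_expand : forall v, v = \sum_i pair (f i) v *: e i.
Hypothesis f_expand : forall g, g = \sum_i pair g (e i) *: f i.

(** Both sides expand into the same double sum over the matrix coefficients of [phi]: one through
    the basis [f] of W, the other through the basis [e] of V. *)
Lemma dual_bases_transpose (F : V -> W -> Z) (phi : V -> V) (psi : W -> W) :
  bilin F -> (forall g v, pair (psi g) v = pair g (phi v)) ->
  \sum_i F (e i) (psi (f i)) = \sum_i F (phi (e i)) (f i).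
Proof.
move=> Fb psiP.
transitivity (\sum_i \sum_j pair (f i) (phi (e j)) *: F (e i) (f j)).
  apply: eq_bigr => i _; rewrite [psi _]f_expand (bilin_sumr Fb).
  by apply: eq_bigr => j _; rewrite (bilinZr Fb) psiP.
rewrite exchange_big; apply: eq_bigr => j _.
rewrite [in RHS](e_expand (phi _)) (bilin_suml Fb).
by apply: eq_bigr => i _; rewrite (bilinZl Fb).
Qed.

Variables (mul : A -> A -> A) (l r : A -> V -> V) (ls rs : A -> W -> W).
Hypothesis lsP : forall x g v, pair (ls x g) v = pair g (r x v).
Hypothesis rsP : forall x g v, pair (rs x g) v = pair g (l x v).
Variable T : V -> A.
Hypothesis T_linear : linear T.
Hypothesis T_oop : oop mul l r T.

(** Transposition moves the dual actions from W back to V, where they become [T (r (T (e j)) (e i))]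
    and [T (l (T (e i)) (e j))]. By the O-operator equation these add up to the product in the first
    term. *)
Lemma oop_cancel (K : A -> W -> W -> Z) :
  (forall h, bilin (fun x g => K x g h)) ->
  (forall g, bilin (fun x h => K x g h)) ->
  \sum_i \sum_j (K (mul (T (e i)) (T (e j))) (f i) (f j)
    - K (T (e j)) (ls (T (e i)) (f j)) (f i)
    - K (T (e i)) (f j) (rs (T (e j)) (f i))) = 0.
Proof.
move=> Kl Kr.
have Kl' h : bilin (fun v g => K (T v) g h).
  exact: (bilin_comp T_linear (@linear_id _ _) (Kl h)).
have Kr' g : bilin (fun v h => K (T v) g h).
  exact: (bilin_comp T_linear (@linear_id _ _) (Kr g)).
under eq_bigr do rewrite !sumrB; rewrite !sumrB.
have -> : \sum_i \sum_j K (T (e j)) (ls (T (e i)) (f j)) (f i) =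
    \sum_i \sum_j K (T (r (T (e j)) (e i))) (f i) (f j).
  rewrite [RHS]exchange_big; apply: eq_bigr => i _.
  by apply: (dual_bases_transpose (Kl' (f i))) => g v; rewrite lsP.
have -> : \sum_i \sum_j K (T (e i)) (f j) (rs (T (e j)) (f i)) =
    \sum_i \sum_j K (T (l (T (e i)) (e j))) (f i) (f j).
  rewrite exchange_big; apply: eq_bigr => j _.
  by apply: (dual_bases_transpose (Kr' (f j))) => g v; rewrite rsP.
apply/eqP; rewrite -addrA -opprD subr_eq0 -big_split; apply/eqP/eq_bigr => i _.
rewrite -big_split; apply: eq_bigr => j _ /=.
by rewrite T_oop (bilinDl (Kl (f j))) addrC.
Qed.

Variables (B Y : lmodType R) (iA : {linear A -> B}) (iW : {linear W -> B}).
Variable mulB : B -> B -> B.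
Hypothesis mulB_bilin : bilin mulB.
Hypothesis mulB_AA : forall x y, mulB (iA x) (iA y) = iA (mul x y).
Hypothesis mulB_AW : forall x g, mulB (iA x) (iW g) = iW (ls x g).
Hypothesis mulB_WA : forall g x, mulB (iW g) (iA x) = iW (rs x g).
Hypothesis mulB_WW : forall g h, mulB (iW g) (iW h) = 0.
Variables (ten2 : B -> B -> Y) (ten : Y -> B -> Z).
Hypothesis ten2_bilin : bilin ten2.
Hypothesis ten_bilin : bilin ten.
(* [lift F] stands for the value at the tensor
   [\sum_i (T e_i (x) f_i - f_i (x) T e_i)] of the linear map induced by F. *)
Variable lift : (B -> B -> Z) -> Z.
Hypothesis liftE : forall F, bilin F -> lift F =
  \sum_i (F (iA (T (e i))) (iW (f i)) - F (iW (f i)) (iA (T (e i)))).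

(** For each pair of indices the four sign patterns give twelve terms. Three contain a product of
    two elements of W and vanish; the other nine form three groups, each killed by [oop_cancel]. *)
Lemma oop_aybe :
  lift (fun a b => lift (fun a' b' =>
    ten (ten2 (mulB a a') b) b' + ten (ten2 a a') (mulB b b')
    - ten (ten2 a' (mulB a b')) b)) = 0.
Proof.
pose ten3 a b c := ten (ten2 a b) c.
pose term a b a' b' :=
  ten3 (mulB a a') b b' + ten3 a a' (mulB b b') - ten3 a' (mulB a b') b.
rewrite -[LHS]/(lift (fun a b => lift (fun a' b' => term a b a' b'))).
have ten3_bilin12 c : bilin (fun a b => ten3 a b c).
  exact: bilin_postcomp (ten_bilin.1 c) ten2_bilin.
have ten3_bilin13 b : bilin (fun a c => ten3 a b c).
  exact: bilin_comp (ten2_bilin.1 b) (@linear_id _ _) ten_bilin.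
have ten3_bilin23 a : bilin (fun b c => ten3 a b c).
  exact: bilin_comp (ten2_bilin.2 a) (@linear_id _ _) ten_bilin.
have term_bilin1 a' b' : bilin (fun a b => term a b a' b').
  apply: bilin_add; [apply: bilin_add|apply: bilin_opp].
  - exact: bilin_comp (mulB_bilin.1 a') (@linear_id _ _) (ten3_bilin12 b').
  - exact: bilin_comp (@linear_id _ _) (mulB_bilin.1 b') (ten3_bilin13 a').
  - exact: bilin_comp (mulB_bilin.1 b') (@linear_id _ _) (ten3_bilin23 a').
have term_bilin2 a b : bilin (fun a' b' => term a b a' b').
  apply: bilin_add; [apply: bilin_add|apply: bilin_opp].
  - exact: bilin_comp (mulB_bilin.2 a) (@linear_id _ _) (ten3_bilin13 b).
  - exact: bilin_comp (@linear_id _ _) (mulB_bilin.2 b) (ten3_bilin23 a).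
  - exact: bilin_comp (@linear_id _ _) (mulB_bilin.2 a) (ten3_bilin12 b).
have ten3_0 b c : (ten3 0 b c = 0) * (ten3 b 0 c = 0) * (ten3 b c 0 = 0).
  rewrite (bilin0l (ten3_bilin12 c)) (bilin0r (ten3_bilin12 c)).
  by rewrite (bilin0r (ten3_bilin23 b)).
pose a i := iA (T (e i)); pose g i := iW (f i).
(* [liftE] requires a bilinear argument, so the inner lift is expanded first, for fixed outer
   arguments. *)
have -> : (fun x y => lift (fun a' b' => term x y a' b')) =
    (fun x y => \sum_i (term x y (a i) (g i) - term x y (g i) (a i))).
  by apply/funext => x; apply/funext => y; rewrite (liftE (term_bilin2 x y)).
rewrite liftE; last first.
  apply: bilin_sum => j; apply: bilin_add; first exact: term_bilin1.
  exact/bilin_opp/term_bilin1.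
rewrite -/(a _) -/(g _).
(* The three test maps are the cyclic rotations of one another, with the factor from A in the first,
   second and third slot. *)
have K1 := oop_cancel (K := fun x h h' => ten3 (iA x) (iW h) (iW h')) _ _.
have K2 := oop_cancel (K := fun x h h' => ten3 (iW h') (iA x) (iW h)) _ _.
have K3 := oop_cancel (K := fun x h h' => ten3 (iW h) (iW h') (iA x)) _ _.
transitivity (
  \sum_i \sum_j (ten3 (iA (mul (T (e i)) (T (e j)))) (g i) (g j)
     - ten3 (a j) (iW (ls (T (e i)) (f j))) (g i)
     - ten3 (a i) (g j) (iW (rs (T (e j)) (f i)))) +
  \sum_i \sum_j (ten3 (g j) (iA (mul (T (e i)) (T (e j)))) (g i)
     - ten3 (g i) (a j) (iW (ls (T (e i)) (f j)))
     - ten3 (iW (rs (T (e j)) (f i))) (a i) (g j)) +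
  \sum_i \sum_j (ten3 (g i) (g j) (iA (mul (T (e i)) (T (e j))))
     - ten3 (iW (ls (T (e i)) (f j))) (g i) (a j)
     - ten3 (g j) (iW (rs (T (e j)) (f i))) (a i))); last first.
  rewrite K1 ?K2 ?K3 ?addr0 // => h.
  - exact: bilin_comp (linearP iA) (linearP iW) (bilin_swap (ten3_bilin13 _)).
  - exact: bilin_comp (linearP iA) (linearP iW) (bilin_swap (ten3_bilin23 _)).
  - exact: bilin_comp (linearP iA) (linearP iW) (ten3_bilin23 _).
  - exact: bilin_comp (linearP iA) (linearP iW) (bilin_swap (ten3_bilin12 _)).
  - exact: bilin_comp (linearP iA) (linearP iW) (ten3_bilin12 _).
  - exact: bilin_comp (linearP iA) (linearP iW) (ten3_bilin13 _).
rewrite -!big_split; apply: eq_bigr => i _ /=.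
rewrite -sumrB -!big_split; apply: eq_bigr => j _ /=.
rewrite /term !(mulB_AA, mulB_AW, mulB_WA, mulB_WW, ten3_0).
rewrite !(subr0, sub0r, addr0, add0r) !opprD !opprK.
by rewrite [LHS](AC (2*3*(2*2)) ((1*2*4)*(5*7*6)*(8*3*9))).
Qed.

End DualBases.

(** * Constant series and reduction mod h *)

Section PowserConstants.
Variables (k : comNzRingType) (U V W : lmodType k).

Lemma cst0 : cst (0 : V) = 0.
Proof. by apply/powserP => n; rewrite /cst; case: eqP. Qed.

Lemma powmap_cst (f : U -> V) x : f 0 = 0 -> powmap f (cst x) = cst (f x).
Proof. by move=> f0; apply/powserP => n; rewrite /powmap /cst; case: eqP. Qed.

Lemma cauchy_cstl (f : U -> V -> W) x v n :
  bilin f -> cauchy f (cst x) v n = f x (v n).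
Proof.
move=> fb; rewrite /cauchy big_ord_recl /= subn0 big1 ?addr0 // => i _.
by rewrite /cst (bilin0l fb).
Qed.

Lemma cauchy_cstr (f : U -> V -> W) u y n :
  bilin f -> cauchy f u (cst y) n = f (u n) y.
Proof.
move=> fb; rewrite cauchy_rev big_ord_recl /= subn0 big1 ?addr0 // => i _.
by rewrite /cst (bilin0r fb).
Qed.

Lemma cauchy_cst (f : U -> V -> W) x y :
  bilin f -> cauchy f (cst x) (cst y) = cst (f x y).
Proof.
move=> fb; apply/powserP => n; rewrite cauchy_cstl // /cst.
by case: eqP; rewrite ?(bilin0r fb).
Qed.

Lemma cstZ (a : k) (v : powser V) n : ((cst a : powser k) *: v) n = a *: v n.
Proof.
by rewrite powserZ big_ord_recl subn0 big1 ?addr0 // => i _; rewrite scale0r.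
Qed.

Lemma cst_linear a (x y : V) :
  cst (a *: x + y) = (cst a : powser k) *: cst x + cst y.
Proof.
apply/powserP => n; rewrite powserD cstZ /cst.
by case: eqP; rewrite ?scaler0 ?addr0.
Qed.

Lemma cst_sum (I : finType) (x : I -> V) :
  cst (\sum_i x i) = \sum_i cst (x i).
Proof.
apply: (big_morph (@cst V)) => [x' y|]; last exact: cst0.
by apply/powserP => n; rewrite powserD /cst; case: eqP; rewrite ?addr0.
Qed.

Lemma cst_hvar_expand (u : powser V) :
  u = cst (u 0%N) + hvar k *: ((fun n => u n.+1) : powser V).
Proof.
by apply/powserP => -[|n]; rewrite powserD ?hvarZ0 ?hvarZS ?addr0 ?add0r.
Qed.
End PowserConstants.

(** * The quasiclassical limit of a deformation is a Poisson algebra *)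

Section QuasiclassicalLimit.
Variables (k : fieldType) (A : lmodType k) (mul br : A -> A -> A).
Variable mulh : powser A -> powser A -> powser A.
Hypothesis mul_comm_assoc : comm_assoc_alg mul.
Hypothesis mulh_deformation : assoc_deformation mul mulh.
Hypothesis mulh_qcl : qcl mulh br.

Let mulC : commutative mul := mul_comm_assoc.2.
Let mulh_bilin : bilin mulh := mulh_deformation.1.1.
Let mulhA : associative mulh := mulh_deformation.1.2.

(** The deformation condition speaks of constants only. By K-bilinearity the remainders of [u] and
    [v] contribute multiples of h. *)
Lemma deformation_coef0 u v : mulh u v 0%N = mul (u 0%N) (v 0%N).
Proof.
rewrite [u in LHS](cst_hvar_expand u) [v in LHS](cst_hvar_expand v).
rewrite (bilinDl mulh_bilin) (bilinZl mulh_bilin) powserD hvarZ0 addr0.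
rewrite (bilinDr mulh_bilin) (bilinZr mulh_bilin) powserD hvarZ0 addr0.
exact/eqmodhP/(mulh_deformation.2 _ _).
Qed.

Let com u v := mulh u v - mulh v u.

Let com_bilin : bilin com.
Proof. exact: bilin_add mulh_bilin (bilin_opp (bilin_swap mulh_bilin)). Qed.

Let com_coef0 u v : com u v 0%N = 0.
Proof. by rewrite /com powserD powserN !deformation_coef0 mulC subrr. Qed.

Let com_cst x y : com (cst x) (cst y) 1%N = br x y.
Proof. by have /eqmodh_quotP[] := mulh_qcl x y. Qed.

(** A commutator already vanishes mod h, so the parts of [u] and [v] divisible by h only enter from
    h^2 on. *)
Let com_coef1 u v : com u v 1%N = br (u 0%N) (v 0%N).
Proof.
rewrite [u in LHS](cst_hvar_expand u) [v in LHS](cst_hvar_expand v).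
rewrite (bilinDl com_bilin) (bilinZl com_bilin) powserD hvarZS com_coef0 addr0.
rewrite (bilinDr com_bilin) (bilinZr com_bilin) powserD hvarZS com_coef0 addr0.
exact: com_cst.
Qed.

Let com_hvar x y :
  exists2 w, com (cst x) (cst y) = hvar k *: w & w 0%N = br x y.
Proof. by have [w [cxy /eqmodhP]] := mulh_qcl x y; exists w. Qed.

Let com_jacobi u v w :
  com u (com v w) + com v (com w u) + com w (com u v) = 0.
Proof.
rewrite /com !(bilinDl mulh_bilin) !(bilinDr mulh_bilin).
rewrite !(bilinNl mulh_bilin) !(bilinNr mulh_bilin) !opprD !opprK !mulhA.
(* The twelve triple products cancel in six pairs. *)
rewrite [LHS](AC ((2*2)*(2*2)*(2*2))
  ((1*11)*(8*2)*(5*3)*(4*10)*(12*6)*(9*7))).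
by rewrite /= !subrr !addr0.
Qed.

Let com_leibniz u v w :
  com u (mulh v w) = mulh (com u v) w + mulh v (com u w).
Proof.
rewrite /com !(bilinDl mulh_bilin) !(bilinDr mulh_bilin).
by rewrite !(bilinNl mulh_bilin) !(bilinNr mulh_bilin) !mulhA addrA subrK.
Qed.

Lemma qcl_poisson : poisson_alg br mul.
Proof.
split=> //.
- split=> [y|x] a z t /=; rewrite -!com_cst cst_linear.
    by rewrite (bilinPl com_bilin) powserD cstZ.
  by rewrite (bilinPr com_bilin) powserD cstZ.
- by move=> x; rewrite -com_cst /com subrr.
- move=> x y z; have := com_jacobi (cst x) (cst y) (cst z).
  have [u -> <-] := com_hvar y z; have [v -> <-] := com_hvar z x.
  have [w -> <-] := com_hvar x y.
  (* Each inner commutator is h times a lift of a bracket, and the outer one adds another factor h,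
     so the Jacobi identity appears in degree 2. *)
  rewrite !(bilinZr com_bilin) => /powserP/(_ 2%N).
  by rewrite !powserD !hvarZS !com_coef1.
move=> x y z; have := com_leibniz (cst x) (cst y) (cst z).
have [u -> <-] := com_hvar x y; have [v -> <-] := com_hvar x z.
(* Each term here has a single commutator, so degree 1 is the leading one. *)
rewrite (bilinZl mulh_bilin) (bilinZr mulh_bilin) => /powserP/(_ 1%N).
by rewrite powserD !hvarZS com_coef1 !deformation_coef0.
Qed.
End QuasiclassicalLimit.

(** * Transport of the semidirect product along the identification of pairs of series with series of
    pairs *)

Section SemidirectPowser.
Variables (k : fieldType) (A V : lmodType k).

Lemma hpairK : cancel (@hpair _ A V) (@hunpair _ A V).
Proof. by case=> a v; congr (_, _); apply/powserP. Qed.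

Lemma hunpair_linear : linear (@hunpair _ A V).
Proof.
move=> a p q; congr (_, _); apply/powserP => n;
  by rewrite /powmap !powserD !powserZ raddfD raddf_sum.
Qed.

Lemma hunpairK : cancel (@hunpair _ A V) (@hpair _ A V).
Proof.
move=> p; apply/powserP => n; apply: esym; exact: surjective_pairing.
Qed.

Lemma hpair_linear : linear (@hpair _ A V).
Proof.
move=> a p q; apply: (can_inj hunpairK).
by rewrite hunpair_linear !hpairK.
Qed.

Lemma hsd_mul_assoc mulh (l r : powser A -> powser V -> powser V) :
  assoc_alg (sd_mul mulh l r) -> assoc_alg (hsd_mul mulh l r).
Proof.
case=> mb mA; split.
  exact: (bilin_postcomp hpair_linear
    (bilin_comp hunpair_linear hunpair_linear mb)).
by move=> x y z; rewrite /hsd_mul !hpairK mA.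
Qed.
End SemidirectPowser.

Lemma opp_act_bilin (R : comNzRingType) (A V : lmodType R) (m : A -> V -> V) :
  bilin m -> bilin (opp_act m).
Proof. exact: bilin_opp. Qed.

(** * The pairings over k and over K, with their dual bases *)

Section Pairing.
Variables (k : fieldType) (V : vectType k).

Definition dual_eval (f : dual V) (v : V) : k := f v.

Lemma dual_eval_bilin : bilin (dual_eval : dual V -> V -> k^o).
Proof.
split=> [v|f] a x y; rewrite /dual_eval /=; first exact: dual_lfunP.
by rewrite linearP.
Qed.

Lemma dual_eval_inj f g : dual_eval f =1 dual_eval g -> f = g.
Proof. by move=> fg; apply/lfunP. Qed.

Lemma dual_tbasis_expand (g : dual V) :
  g = \sum_i dual_eval g (tbasis i) *: dual_tbasis i.
Proof.
apply: dual_eval_inj => v; rewrite (bilin_suml dual_eval_bilin).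
rewrite {1}(tbasis_expand v) (bilin_sumr dual_eval_bilin).
apply: eq_bigr => i _; rewrite (bilinZl dual_eval_bilin).
by rewrite (bilinZr dual_eval_bilin) /dual_eval dual_tbasisE; apply: mulrC.
Qed.

Lemma tbasis_dual_expand (v : V) :
  v = \sum_i dual_eval (dual_tbasis i) v *: tbasis i.
Proof.
rewrite {1}(tbasis_expand v); apply: eq_bigr => i _.
by rewrite /dual_eval dual_tbasisE.
Qed.

Lemma hpairing_bilin :
  bilin (@hpairing k V : powser (dual V) -> powser V -> (powser k)^o).
Proof. exact: (cauchy_bilin dual_eval_bilin). Qed.

Lemma hpairing_cstr (f : powser (dual V)) v n :
  hpairing f (cst v) n = dual_eval (f n) v.
Proof. exact: cauchy_cstr dual_eval_bilin. Qed.

Lemma hpairing_cstl (f : dual V) v n :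
  hpairing (cst f) v n = dual_eval f (v n).
Proof. exact: cauchy_cstl dual_eval_bilin. Qed.

(** Constant vectors suffice: pairing with [cst v] evaluates each coefficient of the functional at
    [v]. *)
Lemma hpairing_inj (f g : powser (dual V)) :
  hpairing f =1 hpairing g -> f = g.
Proof.
move=> fg; apply/powserP => n; apply: dual_eval_inj => v.
by rewrite -!hpairing_cstr fg.
Qed.

(** With [hpairing_expandl]: dual bases over k, viewed as constant series, are dual bases over K. *)
Lemma hpairing_expandr (v : powser V) :
  v = \sum_i hpairing (cst (dual_tbasis i)) v *: cst (tbasis i).
Proof.
rewrite {1}(powser_expand v); apply: eq_bigr => i _; congr (_ *: _).
apply/powserP => n; rewrite hpairing_cstl /dual_eval.
by rewrite dual_tbasisE.
Qed.

Lemma hpairing_expandl (g : powser (dual V)) :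
  g = \sum_i hpairing g (cst (tbasis i)) *: cst (dual_tbasis i).
Proof.
apply: hpairing_inj => v; rewrite (bilin_suml hpairing_bilin).
rewrite {1}(hpairing_expandr v) (bilin_sumr hpairing_bilin).
apply: eq_bigr => i _; rewrite (bilinZl hpairing_bilin).
by rewrite (bilinZr hpairing_bilin); apply: mulrC.
Qed.
End Pairing.

Section DualActions.
Variables (k : fieldType) (A V : vectType k).

(** The sign of [opp_act] cancels the one built into [dual_act], which leaves the plain adjoint that
    the abstract lemmas expect. *)
Lemma opp_dual_actP (m : A -> V -> V) : bilin m -> forall x f v,
  dual_eval (opp_act (dual_act m) x f) v = dual_eval f (m x v).
Proof.
move=> mb x f v; rewrite (bilinNl (@dual_eval_bilin k V)).
by rewrite /dual_eval dual_actP // opprK.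
Qed.

Lemma opp_hdual_actP (m : powser A -> powser V -> powser V) :
  bilin m -> forall x f v,
  hpairing (opp_act (hdual_act m) x f) v = hpairing f (m x v).
Proof.
move=> mb x f v; rewrite (bilinNl (@hpairing_bilin k V)).
by rewrite hdual_actP // opprK.
Qed.

Lemma opp_dual_bimodule (mul : A -> A -> A) (l r : A -> V -> V) :
  bimodule mul l r ->
  bimodule mul (opp_act (dual_act r)) (opp_act (dual_act l)).
Proof.
move=> bm; have [lb rb _] := bm.
exact: (dual_bimodule (@dual_eval_bilin k V) (@dual_eval_inj k V)
  (opp_dual_actP rb) (opp_dual_actP lb) bm).
Qed.

Lemma opp_hdual_bimodule mulh (l r : powser A -> powser V -> powser V) :
  bimodule mulh l r ->
  bimodule mulh (opp_act (hdual_act r)) (opp_act (hdual_act l)).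
Proof.
move=> bm; have [lb rb _] := bm.
exact: (dual_bimodule (@hpairing_bilin k V) (@hpairing_inj k V)
  (opp_hdual_actP rb) (opp_hdual_actP lb) bm).
Qed.

Lemma opp_dual_act_bilin (m : A -> V -> V) :
  bilin m -> bilin (opp_act (dual_act m)).
Proof.
move=> mb.
exact: (adjoint_bilin (@dual_eval_bilin k V) (@dual_eval_inj k V)
  (opp_dual_actP mb) mb).
Qed.

Lemma opp_hdual_act_bilin (m : powser A -> powser V -> powser V) :
  bilin m -> bilin (opp_act (hdual_act m)).
Proof.
move=> mb.
exact: (adjoint_bilin (@hpairing_bilin k V) (@hpairing_inj k V)
  (opp_hdual_actP mb) mb).
Qed.

Lemma opp_hdual_act_cst (m : powser A -> powser V -> powser V) x f n v :
  bilin m ->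
  dual_eval (opp_act (hdual_act m) (cst x) (cst f) n) v =
  dual_eval f (m (cst x) (cst v) n).
Proof.
by move=> mb; rewrite -hpairing_cstr opp_hdual_actP // hpairing_cstl.
Qed.
End DualActions.

(** * The dual semidirect product: its deformation and its quasiclassical limit *)

Section BimoduleDeformation.
Variables (k : fieldType) (A V : vectType k).
Variables (mul br : A -> A -> A) (rho rb : A -> V -> V).
Variable mulh : powser A -> powser A -> powser A.
Variables lh rh : powser A -> powser V -> powser V.
Hypothesis mul_comm_assoc : comm_assoc_alg mul.
Hypothesis rho_bimodule : bimodule mul rho rho.
Hypothesis mulh_deformation : assoc_deformation mul mulh.
Hypothesis mulh_qcl : qcl mulh br.
Hypothesis lrh_deformation : bimodule_deformation mul rho rho mulh lh rh.
Hypothesis lrh_qcl : qcl_module lh rh rb.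

Let rho_bilin : bilin rho. Proof. by case: rho_bimodule. Qed.
Let lh_bilin : bilin lh. Proof. by case: lrh_deformation => [[]]. Qed.
Let rh_bilin : bilin rh. Proof. by case: lrh_deformation => [[]]. Qed.

(** Multiplying [(x, 0)] and [(0, v)] in either order isolates one of the two actions, and the
    deformation condition prescribes both products mod h. *)
Let lh_rh_coef0 x v :
  (lh (cst x) (cst v) 0%N = rho x v) * (rh (cst x) (cst v) 0%N = rho x v).
Proof.
have [_ [_ H]] := lrh_deformation.
split; [have /eqmodhP := H (x, 0) (0, v)|have /eqmodhP := H (0, v) (x, 0)];
  rewrite /hsd_mul /hunpair !powmap_cst // /hpair /sd_mul /= !cst0 => -[_];
  by rewrite (bilin0l lh_bilin, bilin0l rh_bilin) (bilin0l rho_bilin)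
    !(add0r, addr0).
Qed.

Lemma qcl_moduleE x u :
  rb x u = lh (cst x) (cst u) 1%N - rh (cst x) (cst u) 1%N.
Proof. by have /eqmodh_quotP[] := lrh_qcl x u. Qed.

Lemma qcl_module_bilin : bilin rb.
Proof.
split=> [u|x] a y z /=; rewrite !qcl_moduleE cst_linear.
  rewrite (bilinPl lh_bilin) (bilinPl rh_bilin) !powserD !cstZ.
  by rewrite opprD addrACA -scalerBr.
rewrite (bilinPr lh_bilin) (bilinPr rh_bilin) !powserD !cstZ.
by rewrite opprD addrACA -scalerBr.
Qed.

Let dmul := sd_mul mul (opp_act (dual_act rho)) (opp_act (dual_act rho)).
Let dbr := sd_br br (dual_act rb).
Let dmulh := hsd_mul mulh (opp_act (hdual_act rh)) (opp_act (hdual_act lh)).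

Lemma dual_comm_assoc : comm_assoc_alg dmul.
Proof.
split; first by have [] := opp_dual_bimodule rho_bimodule.
move=> p q; rewrite /dmul /sd_mul addrC; congr (_, _).
exact: mul_comm_assoc.2.
Qed.

Lemma dual_deformation : assoc_deformation dmul dmulh.
Proof.
split.
  by apply: hsd_mul_assoc; have [] := opp_hdual_bimodule lrh_deformation.1.
move=> [x f] [y g]; apply/eqmodhP.
rewrite /dmulh /hsd_mul /hunpair !powmap_cst // /hpair /dmul /sd_mul /=.
congr (_, _); first exact/eqmodhP/(mulh_deformation.2 x y).
apply: dual_eval_inj => v; rewrite powserD !(bilinDl (@dual_eval_bilin k V)).
by rewrite !opp_hdual_act_cst // !opp_dual_actP // !lh_rh_coef0.
Qed.

(** Dualizing exchanges the left and right actions, so the commutator with a functional involves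
    [rh - lh], whose h-coefficient is minus [rb]. This is the sign inside [dual_act rb], which
    therefore enters without [opp_act]. *)
Lemma dual_qcl : qcl dmulh dbr.
Proof.
move=> [x f] [y g]; apply/eqmodh_quotP; split.
  have H p q := (eqmodhP _ _).1 (dual_deformation.2 p q).
  by rewrite !H; apply: dual_comm_assoc.2.
rewrite /dmulh /hsd_mul /hunpair !powmap_cst // /hpair /dbr /sd_br /sd_mul /=.
have /eqmodh_quotP[_ <-] := mulh_qcl x y.
congr (_, _); apply: dual_eval_inj => v; rewrite !powserD.
have eDl := bilinDl (@dual_eval_bilin k V).
have eNl := bilinNl (@dual_eval_bilin k V).
rewrite !eDl !opp_hdual_act_cst //= eNl eDl.
have rb_bilin := qcl_module_bilin.
rewrite !opp_hdual_act_cst // eNl /dual_eval !dual_actP //.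
rewrite -!/(dual_eval _ _) !qcl_moduleE.
have eDr := bilinDr (@dual_eval_bilin k V).
have eNr := bilinNr (@dual_eval_bilin k V).
rewrite !eDr !eNr opprB opprK opprD.
by rewrite [- _ - _]addrC addrACA.
Qed.
End BimoduleDeformation.

Lemma powmap_linear (k : comNzRingType) (U V : lmodType k)
    (f : {linear U -> V}) : linear (powmap f : powser U -> powser V).
Proof.
move=> a u v; apply/powserP => n.
rewrite powserD /powmap powserD linearD !powserZ linear_sum; congr (_ + _).
by apply: eq_bigr => i _; rewrite linearZ.
Qed.

(** * Linearity of induced maps and their values on constant tensors *)

Section LiftLinear.
Variables (k : fieldType) (V W : vectType k).

HB.instance Definition _ (Z : lmodType k) (f : V -> W -> Z) :=
  GRing.isLinear.Build k (tensor V W) Z *:%R (tlift f) (tlift_linear f).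

HB.instance Definition _ :=
  GRing.isLinear.Build k (tensor V W) (tensor W V) *:%R (@flip k V W)
    (tlift_linear _).

Lemma flip_tens (v : V) (w : W) : flip (tens v w) = tens w v.
Proof. exact: (tlift_tens (bilin_swap (@tens_bilin k W V))). Qed.

Lemma hlift_linear (Z : lmodType (powser k)) (f : powser V -> powser W -> Z) :
  linear (hlift f).
Proof.
move=> a s t; rewrite /hlift scaler_sumr -big_split; apply: eq_bigr => i _.
rewrite scaler_sumr -big_split; apply: eq_bigr => j _ /=.
rewrite scalerA -scalerDl; congr (_ *: _); apply/powserP => n.
rewrite powserD powserD powserZ !mxE summxE; congr (_ + _).
by apply: eq_bigr => m _; rewrite mxE.
Qed.
HB.instance Definition _ (Z : lmodType (powser k)) f :=
  GRing.isLinear.Build (powser k) (powser (tensor V W)) Z *:%R (hlift f)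
    (@hlift_linear Z f).

Lemma htens_cst (v : V) (w : W) : htens (cst v) (cst w) = cst (tens v w).
Proof. exact: cauchy_cst (@tens_bilin k V W). Qed.

(** The coordinates of a constant tensor are constant series, so both lifts are the same finite
    sum. *)
Lemma hlift_cst (Z : lmodType k) (f : V -> W -> Z)
    (fh : powser V -> powser W -> powser Z) t :
  (forall v w, fh (cst v) (cst w) = cst (f v w)) ->
  hlift fh (cst t) = cst (tlift f t).
Proof.
move=> fhE; rewrite cst_sum; apply: eq_bigr => i _.
rewrite cst_sum; apply: eq_bigr => j _; rewrite fhE.
apply/powserP => n; rewrite powserZ big_ord_recl subn0 big1 ?addr0 => [|m _].
  by rewrite /cst /=; case: (n == 0%N); rewrite ?scaler0.
by rewrite /cst /= mxE scale0r.
Qed.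
End LiftLinear.

(** * The skew-symmetric tensor of a linear map and its scalar deformation *)

Section OOperatorTensor.
Variables (k : fieldType) (A V : vectType k) (T : 'Hom(V, A)).
Let B : vectType k := (A * dual V)%type.

Lemma eta_tens (a : A) (f : dual V) :
  eta (tens a f) = tens ((a, 0) : B) ((0, f) : B).
Proof.
apply: tlift_tens; apply: bilin_comp (@tens_bilin k B B) => c x y;
  by congr (_, _); rewrite /= scaler0 addr0.
Qed.

Lemma rtensorE : rtensor T =
  \sum_i (tens ((T (tbasis i), 0) : B) ((0, dual_tbasis i) : B)
    - tens ((0, dual_tbasis i) : B) ((T (tbasis i), 0) : B)).
Proof.
have etaE : eta (tilde T) =
    \sum_i tens ((T (tbasis i), 0) : B) ((0, dual_tbasis i) : B).
  rewrite /eta /tilde linear_sum; apply: eq_bigr => i _; exact: eta_tens.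
rewrite /rtensor etaE sumrB; congr (_ - _); rewrite linear_sum.
by apply: eq_bigr => i _ /=; rewrite flip_tens.
Qed.

Lemma flip_rtensor : flip (rtensor T) = - rtensor T.
Proof.
rewrite rtensorE linear_sum -sumrN; apply: eq_bigr => i _.
by rewrite linearB /= !flip_tens opprB.
Qed.

(** The scalar deformation of T, the embedding and the flip all send constants to constants, and the
    bases used are constant; no positive power of h arises. *)
Lemma rtensorh_cst : rtensorh (powmap T) = cst (rtensor T).
Proof.
have htildeE : htilde (powmap T) = cst (tilde T).
  rewrite cst_sum; apply: eq_bigr => i _.
  by rewrite powmap_cst ?linear0 // htens_cst.
have etahE : etah (htilde (powmap T)) = cst (eta (tilde T)).
  rewrite htildeE; apply: hlift_cst => a f; rewrite -htens_cst.
  by congr htens; apply/powserP => n; rewrite /cst /hpair /=; case: eqP.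
rewrite /rtensorh etahE; apply/powserP => n; rewrite powserD powserN.
by rewrite /powmap /cst; case: eqP => _ //; rewrite linear0 subrr.
Qed.
End OOperatorTensor.

(** * Solutions of the AYBE from O-operators, over k and over K *)

Section YangBaxterSolutions.
Variables (k : fieldType) (A V : vectType k) (T : 'Hom(V, A)).
Let B : vectType k := (A * dual V)%type.

Lemma pairl_linear : linear (fun x : A => (x, 0) : B).
Proof. by move=> a x y; congr (_, _); rewrite /= scaler0 addr0. Qed.

Lemma pairr_linear : linear (fun f : dual V => (0, f) : B).
Proof. by move=> a x y; congr (_, _); rewrite /= scaler0 addr0. Qed.

(** [oop_aybe] for evaluation of functionals. Keeping [l] and [r] separate allows [mul] to be a
    bracket later, with [r] the negative of [l]. *)
Lemma oop_skew_aybe_sol (mul : A -> A -> A) (l r : A -> V -> V) :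
  bilin mul -> bilin l -> bilin r -> oop mul l r T ->
  skew_aybe_sol (sd_mul mul (opp_act (dual_act r)) (opp_act (dual_act l)))
    (rtensor T).
Proof.
move=> mb lb rb To; split; first exact: flip_rtensor.
have lsb := opp_dual_act_bilin lb; have rsb := opp_dual_act_bilin rb.
pose iA : {linear A -> B} :=
  HB.pack (fun x : A => (x, 0) : B)
    (GRing.isLinear.Build _ _ _ _ _ pairl_linear).
pose iW : {linear dual V -> B} :=
  HB.pack (fun f : dual V => (0, f) : B)
    (GRing.isLinear.Build _ _ _ _ _ pairr_linear).
apply: (oop_aybe (@tbasis_dual_expand k V) (@dual_tbasis_expand k V)
  (opp_dual_actP rb) (opp_dual_actP lb) (linearP T) To
  (iA := iA) (iW := iW) (sd_mul_bilin mb rsb lsb) _ _ _ _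
  (@tens_bilin k B B) (@tens_bilin k _ B)
  (lift := fun F => tlift F (rtensor T))).
- move=> x y; congr (_, _); rewrite /=.
  by rewrite (bilin0r lsb) (bilin0r rsb) addr0.
- move=> x g; congr (_, _); rewrite /= ?(bilin0r mb) //.
  by rewrite (bilin0r lsb) addr0.
- move=> g x; congr (_, _); rewrite /= ?(bilin0l mb) //.
  by rewrite (bilin0r rsb) add0r.
- move=> g h; congr (_, _); rewrite /= ?(bilin0l mb) //.
  by rewrite (bilin0l lsb) (bilin0l rsb) addr0.
move=> F Fb; rewrite rtensorE linear_sum; apply: eq_bigr => i _.
by rewrite linearB /= !tlift_tens.
Qed.

Lemma hpair_cstl (x : A) :
  hpair (cst x, 0 : powser (dual V)) = cst ((x, 0) : B).
Proof. by apply/powserP => n; rewrite /hpair /cst /=; case: eqP. Qed.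

Lemma hpair_cstr (f : dual V) : hpair (0 : powser A, cst f) = cst ((0, f) : B).
Proof. by apply/powserP => n; rewrite /hpair /cst /=; case: eqP. Qed.

Lemma hpairl_linear :
  linear (fun x : powser A => hpair (x, 0 : powser (dual V))).
Proof.
move=> a x y; rewrite -hpair_linear; congr hpair.
by congr (_, _); rewrite /= scaler0 addr0.
Qed.

Lemma hpairr_linear :
  linear (fun f : powser (dual V) => hpair (0 : powser A, f)).
Proof.
move=> a x y; rewrite -hpair_linear; congr hpair.
by congr (_, _); rewrite /= scaler0 addr0.
Qed.

Lemma oop_skew_haybe_sol mulh (l r : powser A -> powser V -> powser V) :
  bilin mulh -> bilin l -> bilin r -> oop mulh l r (powmap T) ->
  skew_haybe_sol (hsd_mul mulh (opp_act (hdual_act r)) (opp_act (hdual_act l)))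
    (rtensorh (powmap T)).
Proof.
move=> mb lb rb To; rewrite rtensorh_cst; split.
  rewrite powmap_cst ?linear0 // flip_rtensor.
  by apply/powserP => n; rewrite powserN /cst; case: eqP; rewrite ?oppr0.
have lsb := opp_hdual_act_bilin lb; have rsb := opp_hdual_act_bilin rb.
pose iA : {linear powser A -> powser B} :=
  HB.pack (fun x : powser A => hpair (x, 0) : powser B)
    (GRing.isLinear.Build _ _ _ _ _ hpairl_linear).
pose iW : {linear powser (dual V) -> powser B} :=
  HB.pack (fun f : powser (dual V) => hpair (0, f) : powser B)
    (GRing.isLinear.Build _ _ _ _ _ hpairr_linear).
have Tl : linear (powmap T : powser V -> powser A) by exact: powmap_linear.
have hmb := bilin_postcomp (@hpair_linear _ A (dual V))
    (bilin_comp (@hunpair_linear _ _ _) (@hunpair_linear _ _ _)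
       (sd_mul_bilin mb rsb lsb)).
apply: (oop_aybe (@hpairing_expandr k V) (@hpairing_expandl k V)
  (opp_hdual_actP rb) (opp_hdual_actP lb) Tl To
  (iA := iA) (iW := iW) hmb _ _ _ _
  (@htens_bilin k B B) (@htens_bilin k _ B)
  (lift := fun F => hlift F (cst (rtensor T)))).
- move=> x y; rewrite /= /hsd_mul !hpairK; congr (hpair (_, _)); rewrite /=.
  by rewrite (bilin0r lsb) (bilin0r rsb) addr0.
- move=> x g; rewrite /= /hsd_mul !hpairK; congr (hpair (_, _));
    rewrite /= ?(bilin0r mb) //.
  by rewrite (bilin0r lsb) addr0.
- move=> g x; rewrite /= /hsd_mul !hpairK; congr (hpair (_, _));
    rewrite /= ?(bilin0l mb) //.
  by rewrite (bilin0r rsb) add0r.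
- move=> g h; rewrite /= /hsd_mul !hpairK /sd_mul /=.
  rewrite (bilin0l mb) (bilin0l lsb) (bilin0l rsb) addr0.
  exact/powserP.
(* [r_h] is a constant tensor, so its lift is computed from the expansion of [rtensor T] in pure
   tensors over k. *)
move=> F Fb; rewrite rtensorE cst_sum linear_sum; apply: eq_bigr => i _.
rewrite /= powmap_cst ?linear0 // !hpair_cstl !hpair_cstr.
rewrite -!(hlift_htens Fb) !htens_cst -linearB; congr (hlift _ _).
by apply/powserP => n; rewrite powserD powserN /cst; case: eqP; rewrite ?subr0.
Qed.

End YangBaxterSolutions.

(** * The CYBE as an AYBE for an antisymmetric product *)

Section ClassicalYangBaxter.
Variables (k : fieldType) (B : vectType k).

(** One summation index per copy of the tensor, so that swapping the copies is an exchange of two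
    sums. *)
Lemma tlift2E (Z : lmodType k) (E : B -> B -> B -> B -> Z) (t : tensor B B) :
  tlift (fun a b => tlift (E a b) t) t =
  \sum_(p : 'I_(tdim B) * 'I_(tdim B)) \sum_(q : 'I_(tdim B) * 'I_(tdim B))
    (t p.1 p.2 * t q.1 q.2)
      *: E (tbasis p.1) (tbasis p.2) (tbasis q.1) (tbasis q.2).
Proof.
rewrite /tlift pair_bigA; apply: eq_bigr => p _.
rewrite pair_bigA scaler_sumr; apply: eq_bigr => q _.
by rewrite scalerA.
Qed.

(* Exchanging the two copies of [r] turns the middle term of the CYBE into the
   last term of the AYBE. *)
Lemma cyb_ayb (br : B -> B -> B) (r : tensor B B) :
  (forall x y, br x y = - br y x) -> cyb br r = ayb br r.
Proof.
move=> brC; rewrite /cyb /ayb !tlift2E.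
under eq_bigr => p _ do under eq_bigr => q _ do rewrite addrAC scalerDr.
under [RHS]eq_bigr => p _ do under eq_bigr => q _ do rewrite scalerDr.
under eq_bigr => p _ do rewrite big_split.
under [RHS]eq_bigr => p _ do rewrite big_split.
rewrite !big_split; congr (_ + _).
rewrite [RHS]exchange_big; apply: eq_bigr => p _; apply: eq_bigr => q _ /=.
rewrite mulrC /tens3 brC (bilinNr (@tens_bilin k B B)).
by rewrite (bilinNl (@tens_bilin k _ B)).
Qed.
End ClassicalYangBaxter.

Lemma alternating_antisym (R : comNzRingType) (A : lmodType R)
    (br : A -> A -> A) :
  bilin br -> (forall x, br x x = 0) -> forall x y, br x y = - br y x.
Proof.
move=> bb b0 x y; apply/eqP; rewrite -addr_eq0; apply/eqP.
have := b0 (x + y); rewrite (bilinDl bb) !(bilinDr bb) !b0.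
by rewrite add0r addr0.
Qed.

(** The bracket of the semidirect product is the product [sd_mul] with dual actions coming from
    [l = rb] and [r = - rb], and the bracket condition on T is [oop] for this pair of actions. *)
Lemma oop_skew_cybe_sol (k : fieldType) (A V : vectType k) (T : 'Hom(V, A))
    (br : A -> A -> A) (rb : A -> V -> V) :
  bilin br -> bilin rb ->
  (forall x y, sd_br br (dual_act rb) x y = - sd_br br (dual_act rb) y x) ->
  (forall u v, br (T u) (T v) = T (rb (T u) v) - T (rb (T v) u)) ->
  cyb (sd_br br (dual_act rb)) (rtensor T) = 0.
Proof.
move=> bb rbb brC To; rewrite cyb_ayb //.
have nrbb := opp_act_bilin rbb.
have -> : sd_br br (dual_act rb) = sd_mul br
    (opp_act (dual_act (opp_act rb))) (opp_act (dual_act rb)).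
  apply/funext => -[x f]; apply/funext => -[y g]; congr (_, _ + _) => /=.
  apply: dual_eval_inj => v; rewrite opp_dual_actP //.
  by rewrite (bilinNr (@dual_eval_bilin k V)) /dual_eval dual_actP.
apply: (oop_skew_aybe_sol bb rbb nrbb _).2 => u v.
by rewrite To -linearN.
Qed.

Theorem theorem4p18
  (k : fieldType) (char_k : [pchar k] =i pred0)
  (A V : vectType k)
  (mul br : A -> A -> A) (rho rb : A -> V -> V)
  (mulh : powser A -> powser A -> powser A)
  (lh rh : powser A -> powser V -> powser V)
  (T : 'Hom(V, A)) :
  comm_assoc_alg mul ->
  bimodule mul rho rho ->
  assoc_deformation mul mulh ->
  qcl mulh br ->
  bimodule_deformation mul rho rho mulh lh rh ->
  qcl_module lh rh rb ->
  let TK : powser V -> powser A := powmap T in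
  (* A |x V^*, its bracket, and A_h |x V_h^* *)
  let dmul := sd_mul mul (opp_act (dual_act rho)) (opp_act (dual_act rho)) in
  let dbr := sd_br br (dual_act rb) in
  let dmulh :=
    hsd_mul mulh (opp_act (hdual_act rh)) (opp_act (hdual_act lh)) in
  let r := rtensor T in
  let r_h := rtensorh TK in
  [/\ comm_assoc_alg dmul,
      bimodule mulh (opp_act (hdual_act rh)) (opp_act (hdual_act lh)),
      assoc_deformation dmul dmulh,
      poisson_alg dbr dmul
    & qcl dmulh dbr] /\
  (oop mul rho rho T ->
   oop mulh lh rh TK ->
   [/\ skew_haybe_sol dmulh r_h, skew_aybe_sol dmul r & r_h = cst r] /\
   [/\ (forall u, eqmodh (TK (cst u)) (T u)),
       poisson_oop br mul rb rho T,
       skew_pybe_sol dbr dmul r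
     & forall s, eqmodh r_h s <-> s = r]).
Proof.
move=> mulP rhoP mulhP brP lrP rbP TK dmul dbr dmulh r r_h.
have dmulP : comm_assoc_alg dmul := dual_comm_assoc mulP rhoP.
have dmulhP : assoc_deformation dmul dmulh by exact: dual_deformation.
have dbrP : qcl dmulh dbr by exact: (dual_qcl mulP rhoP).
(* The Poisson axioms on the dual semidirect product come from its deformation rather than from a
   direct check. *)
have dpoisson : poisson_alg dbr dmul := qcl_poisson dmulP dmulhP dbrP.
split; first by split=> //; exact: opp_hdual_bimodule lrP.1.
move=> To TKo; have rhE : r_h = cst r := rtensorh_cst T.
have [rhob _ _] := rhoP; have [lb rb' _] := lrP.1.
have rbb := qcl_module_bilin lrP rbP.
have [_ bb _ _ _] := qcl_poisson mulP mulhP brP.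
have raybe : skew_aybe_sol dmul r := oop_skew_aybe_sol mulP.1.1 rhob rhob To.
(* The h-coefficient of the commutator of the O-operator equation for [TK] on constants: [TK] acts
   coefficientwise, and [lh - rh] has h-coefficient [rb]. *)
have bro u v : br (T u) (T v) = T (rb (T u) v) - T (rb (T v) u).
  have /eqmodh_quotP[_ <-] := brP (T u) (T v).
  have TKc w : cst (T w) = TK (cst w) by rewrite /TK powmap_cst ?linear0.
  rewrite !TKc !TKo -!TKc !powserD /TK /powmap.
  rewrite !(qcl_moduleE rbP) !linearB /= opprK opprD.
  by rewrite [LHS](AC (2*2) ((1*4)*(3*2))).
split; split=> //.
- exact: oop_skew_haybe_sol mulhP.1.1 lb rb' TKo.
- by move=> u; apply/eqmodhP.
- split=> //; [exact: raybe.1|exact: raybe.2|].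
  apply: oop_skew_cybe_sol => //.
  by have [_ dbb dalt _ _] := dpoisson; apply: alternating_antisym.
(* Reduction mod h reads off coefficient zero, which for the constant series [r_h] is [r]. *)
- by move=> s; rewrite rhE; split=> [/eqmodhP <-|->] //; apply/eqmodhP.
Qed.
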